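(* Let $S = \langle a_1, \ldots, a_k\rangle$ be a numerical semigroup with minimal generators $a_1 < \cdots < a_k$, $k \ge 2$. For each $i = 1, \ldots, k$, there exists $B_i \in \mathbb{Z}$ such that for every $x \in S$, $$[\tfrac{1}{A}x + a_k, \tfrac{1}{a_i}x - B_i] \cap (g_i\mathbb{Z} + a_i'x) \subseteq \mathcal L_\infty(x,i) \subseteq g_i\mathbb{Z} + a_i' x.$$
   Context: A numerical semigroup is a cofinite, additively closed subset $S \subseteq \mathbb{Z}_{\ge 0}$ containing $0$. Notation: $A = a_1 + \cdots + a_k$; $g_i = \gcd(\{a_j : j \neq i\})$; and for each $i$, $a_i' \in \mathbb{Z}$ is a fixed integer with $a_i' a_i \equiv 1 \bmod g_i$. For $x \in S$, $\mathsf Z(x) = \{z \in \mathbb{Z}_{\ge 0}^k : x = z_1a_1 + \cdots + z_ka_k\}$; for $z \in \mathsf Z(x)$, $\ell_\infty(z) = \max(z_1,\ldots,z_k)$; $\mathsf Z(x,i) = \{z \in \mathsf Z(x) : z_i = \ell_\infty(z)\}$; and $\mathcal L_\infty(x,i) = \{\ell_\infty(z) : z \in \mathsf Z(x,i)\}$. The interval $[\alpha,\beta]$ is a real interval (empty if $\alpha > \beta$), and $g_i\mathbb{Z} + a_i'x = \{g_i n + a_i' x : n \in \mathbb{Z}\}$. *)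

(* Defs.v *)
From mathcomp Require Import all_boot all_order all_algebra.
From mathcomp Require Import all_classical all_reals.

Set Implicit Arguments.
Unset Strict Implicit.
Unset Printing Implicit Defensive.

Import Order.TTheory GRing.Theory Num.Theory.

Local Open Scope classical_set_scope.

Definition numerical_semigroup (S : set nat) : Prop :=
  [/\ S 0%N, (forall x y, S x -> S y -> S (x + y)%N) & finite_set (~` S)].

Section Factorizations.
Variables (k : nat) (a : k.-tuple nat).

Definition gen_by (J : {set 'I_k}) : set nat :=
  [set x | exists z : {ffun 'I_k -> nat},
     x = (\sum_(i in J) z i * tnth a i)%N].

(* When a has distinct entries, subsets of indices correspond to subsets of
   generators, so this says that no proper subset generates S. *)
Definition minimal_generators (S : set nat) : Prop :=
  gen_by [set: 'I_k]%SET = S /\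
  forall J : {set 'I_k}, gen_by J = S -> J = [set: 'I_k]%SET.

Definition gen_sum : nat := (\sum_(i < k) tnth a i)%N.

Definition gen_gcd (i : 'I_k) : nat :=
  \big[gcdn/0%N]_(j < k | j != i) tnth a j.

Definition factorization (x : nat) : set {ffun 'I_k -> nat} :=
  [set z | x = (\sum_(i < k) z i * tnth a i)%N].

Definition linf (z : {ffun 'I_k -> nat}) : nat := (\max_(i < k) z i)%N.

Definition factorization_at (x : nat) (i : 'I_k) : set {ffun 'I_k -> nat} :=
  factorization x `&` [set z : {ffun 'I_k -> nat} | z i = linf z].

Definition linf_set (x : nat) (i : 'I_k) : set nat :=
  linf @` factorization_at x i.

End Factorizations.

Definition arith_prog (g c : int) : set int :=
  [set (g * n + c)%R | n in [set: int]].

(* Main.v *)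
Require Import Defs.
From mathcomp Require Import all_boot all_order all_algebra.
From mathcomp Require Import all_classical all_reals.
From mathcomp Require Import zify ring.
Import Order.TTheory GRing.Theory Num.Theory.
Local Open Scope classical_set_scope.
Local Open Scope ring_scope.

(** Write [c] for the largest generator. A factorization of [x] whose maximum
    is attained at [i] with value [m] amounts to an expression of
    [y = x - m a_i] as a combination of the [a_j], [j != i], with coefficients
    between [0] and [m]. Reducing modulo [g_i], which divides every [a_j] with
    [j != i], forces [m] to be congruent to [a'_i x]; this is the second
    inclusion.

    For the first inclusion, [m = a'_i x] modulo [g_i] makes [y] a multiple of
    [g_i], and the upper bound on [m] makes [y] large. All large multiples of
    the gcd of some generators are combinations of these generators
    ([gcd_multiples_eventually_in]), so [y] has an expression with nonnegative
    coefficients, and [B_i] only has to exceed the threshold. The lower bound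
    on [m] says that [y] falls short of the sum of the [m a_j] by at least
    [c] times the sum of the [a_j]. Thus when some coefficient [z_j] exceeds
    [m], another one [z_l] is at most [m - c], by averaging. Trading [a_l]
    copies of [a_j] for [a_j] copies of [a_l] preserves [y], is possible since
    [a_l <= c <= m < z_j], lowers [z_j], and keeps [z_l <= m]. Repeating such trades brings all coefficients
    below [m] ([bounded_combination]). *)

(** The induction is on the number of members: given [a] in [M] and the
    claim for [d], a multiple of [gcdn a d] becomes a multiple of [d] after
    subtracting some [u * a] with [u < d], which costs only a bounded amount. *)
Lemma gcd_multiples_eventually_in (I : finType) (P : pred I) (a : I -> nat)
    (M : nat -> Prop) :
  M 0%N -> (forall x y, M x -> M y -> M (x + y)%N) ->
  (forall j, P j -> M (a j)) ->
  exists C, forall y,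
    (C <= y)%N -> (\big[gcdn/0%N]_(j | P j) a j %| y)%N -> M y.
Proof.
move=> M0 MD Ma; apply: (big_rec (fun d => exists C, forall y,
  (C <= y)%N -> (d %| y)%N -> M y)).
  by exists 0%N => y _; rewrite dvd0n => /eqP ->.
move=> j d Pj [C HC].
have MX u : M (u * a j)%N.
  by elim: u => // u IH; rewrite mulSn; apply: MD (Ma _ Pj) IH.
have [->|d_gt0] := posnP d.
  by exists 0%N => y _; rewrite gcdn0 => /dvdnP[q ->].
exists (C + d * a j)%N => y Cy /dvdnP[q yE].
have [c _ dvd_c] := Bezoutl (a j) d_gt0.
(* As [gcdn d (a j) = - c * a j] modulo [d], the required [u] is
   [- q * c] modulo [d]. *)
pose u := ((q * c * d.-1) %% d)%N.
have lt_ud : (u < d)%N by rewrite ltn_mod.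
have le_u : (u * a j <= d * a j)%N by rewrite leq_mul2r (ltnW lt_ud) orbT.
have dvd_qc : (d %| q * c + u)%N.
  by rewrite /dvdn modnDmr -mulnS prednK // modnMl.
have dvd_y : (d %| y - u * a j)%N.
  have : (d %| y + q * c * a j)%N.
    by rewrite yE gcdnC -mulnA -mulnDr dvdn_mull.
  have -> : (y + q * c * a j = (y - u * a j) + (q * c + u) * a j)%N.
    by rewrite mulnDl; lia.
  by rewrite dvdn_addl // dvdn_mulr.
rewrite -(subnK (_ : (u * a j <= y)%N)); last by lia.
by apply: MD => //; apply: HC => //; lia.
Qed.

(** Induction on the total excess of the coefficients above [m], which a trade
    from a coefficient above [m] to one at most [m - c] strictly lowers. *)
Lemma bounded_combination (I : finType) (P : pred I) (a z : I -> nat)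
    (c m : nat) :
  (forall j, P j -> 0 < a j <= c)%N -> (c <= m)%N ->
  (\sum_(j | P j) z j * a j + c * \sum_(j | P j) a j
     <= m * \sum_(j | P j) a j)%N ->
  exists2 z' : I -> nat,
    (\sum_(j | P j) z' j * a j = \sum_(j | P j) z j * a j)%N &
    forall j, P j -> (z' j <= m)%N.
Proof.
move=> a_bnd le_cm.
have [n] := ubnP (\sum_(j | P j) (z j - m))%N.
elim: n z => // n IH z le_n le_sum.
have [/forallP small|] := boolP [forall j, P j ==> (z j <= m)%N].
  by exists z => // j Pj; apply: (implyP (small j)).
rewrite negb_forall => /existsP[j]; rewrite negb_imply -ltnNge => /andP[Pj lt_mj].
have [l Pl le_lm] : exists2 l, P l & (z l + c <= m)%N.
  have [/existsP[l /andP[Pl ?]]|] := boolP [exists l, P l && (z l + c <= m)%N].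
    by exists l.
  rewrite negb_exists => /forallP big; move: le_sum; rewrite leqNgt.
  rewrite !big_distrr -big_split /=.
  case/negP; rewrite (bigD1 j) //= [X in (_ < X)%N](bigD1 j) //= -addSn.
  apply: leq_add; first by have := a_bnd j Pj; nia.
  apply: leq_sum => t /andP[Pt _]; have := big t; rewrite Pt /= => ?; nia.
have neq_lj : l != j by apply: contraTneq le_lm => ->; lia.
have [/andP[aj_gt0 le_ajc] /andP[al_gt0 le_alc]] := (a_bnd j Pj, a_bnd l Pl).
pose z' t := if t == j then (z j - a l)%N else
             if t == l then (z l + a j)%N else z t.
have z'j : z' j = (z j - a l)%N by rewrite /z' eqxx.
have z'l : z' l = (z l + a j)%N by rewrite /z' (negPf neq_lj) eqxx.
have z'E t : P t && (t != j) && (t != l) -> z' t = z t.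
  by case/andP=> /andP[_ /negPf tj] /negPf tl; rewrite /z' tj tl.
have Pl' : P l && (l != j) by rewrite Pl.
have sum_z' : (\sum_(t | P t) z' t * a t = \sum_(t | P t) z t * a t)%N.
  rewrite !(bigD1 j Pj) /= !(bigD1 l Pl') /= z'j z'l.
  under eq_bigr => t Pt do rewrite z'E //.
  rewrite !addnA; congr addn; nia.
have [||z'' z''E le_z''] := IH z'; last by exists z''; rewrite ?z''E.
  rewrite -ltnS; apply: leq_trans le_n.
  rewrite !(bigD1 j Pj) /= !(bigD1 l Pl') /= z'j z'l.
  under eq_bigr => t Pt do rewrite z'E //.
  by lia.
by rewrite sum_z'.
Qed.

Lemma minimal_generators_gt0 (k : nat) (a : k.-tuple nat) (S : set nat)
    (i : 'I_k) :
  minimal_generators a S -> (0 < tnth a i)%N.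
Proof.
case=> genS minS; rewrite lt0n; apply/negP => /eqP ai0.
suff /minS/setP/(_ i) : gen_by a (~: [set i])%SET = S by rewrite !inE eqxx.
rewrite -genS; apply/seteqP; split=> x [z ->]; exists z.
  rewrite [RHS](bigD1 i) ?inE //= ai0 muln0 add0n.
  by apply: eq_bigl => j; rewrite !inE.
rewrite (bigD1 i) ?inE //= ai0 muln0 add0n.
by apply: eq_bigl => j; rewrite !inE.
Qed.

Lemma sorted_leq_last (s : seq nat) (x : nat) :
  sorted ltn s -> x \in s -> (x <= last 0 s)%N.
Proof.
move=> /(sub_sorted ltnW) sorted_s /(nthP 0%N)[n lt_n <-].
rewrite -nth_last; apply: (sorted_leq_nth leq_trans leqnn) => //;
  by rewrite ?inE; case: (size s) lt_n.
Qed.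

Lemma gen_gcd_dvd (k : nat) (a : k.-tuple nat) (i j : 'I_k) :
  j != i -> (gen_gcd a i %| tnth a j)%N.
Proof. by move=> ji; rewrite /gen_gcd (bigD1 j) //= dvdn_gcdl. Qed.

(** Since [a'] inverts [ai] modulo [g], multiplication by [ai] and by [a']
    exchange the two congruences. *)
Lemma dvdz_sub_inverse (g ai a' x m : int) :
  (a' * ai = 1 %[mod g])%Z ->
  (g %| x - m * ai)%Z <-> (g %| m - a' * x)%Z.
Proof.
move/eqP; rewrite eqz_mod_dvd => /dvdzP[t tE].
split=> /dvdzP[w wE]; apply/dvdzP.
  exists (- m * t - a' * w).
  have -> : m - a' * x = - m * (a' * ai - 1) - a' * (x - m * ai) by ring.
  by rewrite tE wE; ring.
exists (- x * t - ai * w).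
have -> : x - m * ai = - x * (a' * ai - 1) - ai * (m - a' * x) by ring.
by rewrite tE wE; ring.
Qed.

Lemma arith_progP (g c m : int) : arith_prog g c m <-> (g %| m - c)%Z.
Proof.
split=> [[n _ <-]|/dvdzP[n nE]]; first by rewrite addrK dvdz_mulr.
by exists n => //; rewrite mulrC -nE subrK.
Qed.

Lemma linf_set_arith_prog (k : nat) (a : k.-tuple nat) (i : 'I_k) (a' : int)
    (x l : nat) :
  (a' * (tnth a i)%:Z = 1 %[mod (gen_gcd a i)%:Z])%Z ->
  linf_set a x i l -> arith_prog (gen_gcd a i)%:Z (a' * x%:Z) l%:Z.
Proof.
move=> inv_a' [z [xE /= ziE] <-]; apply/arith_progP.
rewrite -(dvdz_sub_inverse _ _ _ _ _ inv_a') -ziE xE (bigD1 i) //=.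
rewrite PoszD PoszM addrAC subrr add0r.
apply: (dvdn_sum (d := gen_gcd a i)) => j ji.
by rewrite dvdn_mull // gen_gcd_dvd.
Qed.

(** The first inclusion, with denominators cleared. *)
Lemma linf_set_contains (k : nat) (a : k.-tuple nat) (i : 'I_k) (c : nat) :
  (forall j, 0 < tnth a j <= c)%N ->
  exists B : nat, forall x m : nat,
    (x + c * gen_sum a <= m * gen_sum a)%N ->
    (m * tnth a i + B <= x)%N ->
    (gen_gcd a i %| x - m * tnth a i)%N ->
    linf_set a x i m.
Proof.
move=> a_bnd.
pose M y := exists z : 'I_k -> nat, y = (\sum_(j | j != i) z j * tnth a j)%N.
have [||j ji|B HB] := @gcd_multiples_eventually_in _ (fun j => j != i)
    (fun j => tnth a j) M.
- by exists (fun=> 0%N); rewrite big1.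
- move=> _ _ [z ->] [w ->]; exists (fun j => z j + w j)%N.
  by rewrite -big_split; apply: eq_bigr => j _; rewrite mulnDl.
- exists (fun t => (t == j) : nat); rewrite (bigD1 j) //= eqxx mul1n.
  by rewrite big1 ?addn0 // => t /andP[_ /negPf ->].
exists B => x m low upp dvd_y.
have [z yE] : M (x - m * tnth a i)%N by apply: HB dvd_y; lia.
have sumE : gen_sum a = (tnth a i + \sum_(j | j != i) tnth a j)%N.
  by rewrite /gen_sum (bigD1 i).
have /andP[ai_gt0 ai_le] := a_bnd i.
have [||z' z'E z'_le] := @bounded_combination _ (fun j => j != i)
    (fun j => tnth a j) z c m (fun j _ => a_bnd j).
- by rewrite -(@leq_pmul2r (gen_sum a)); lia.
- by rewrite -yE; move: low; rewrite sumE; nia.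
pose w := [ffun j : 'I_k => if j == i then m else z' j].
have linf_w : linf w = m.
  apply/eqP; rewrite eqn_leq; apply/andP; split.
    apply/bigmax_leqP => j _; rewrite ffunE.
    by case: eqVneq => // ji; apply: z'_le.
  by rewrite /linf (bigD1 i) //= ffunE eqxx leq_maxl.
exists w => //; split; last by rewrite /= linf_w ffunE eqxx.
rewrite /factorization /= (bigD1 i) //= ffunE eqxx.
under eq_bigr => j /negPf ji do rewrite ffunE ji.
by rewrite z'E -yE; lia.
Qed.

Theorem theorem2p3 (R : realType) (k : nat) (S : set nat) (a : k.-tuple nat)
    (a' : 'I_k -> int)
    (hk : (2 <= k)%N)
    (hS : numerical_semigroup S)
    (ha : sorted ltn a)
    (hmin : minimal_generators a S)
    (ha' : forall i : 'I_k,
       (a' i * (tnth a i)%:Z = 1 %[mod (gen_gcd a i)%:Z])%Z) :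
  forall i : 'I_k, exists B : int, forall x : nat, S x ->
    let AP : set R :=
      [set m%:~R | m in arith_prog (gen_gcd a i)%:Z (a' i * x%:Z)] in
    let L : set R := [set l%:R | l in linf_set a x i] in
    `[ (gen_sum a)%:R^-1 * x%:R + (last 0%N a)%:R,
       (tnth a i)%:R^-1 * x%:R - B%:~R ]%classic `&` AP `<=` L
    /\ L `<=` AP.
Proof.
move=> i; pose c := last 0%N a.
have a_bnd j : (0 < tnth a j <= c)%N.
  by rewrite (minimal_generators_gt0 _ _ _ _ hmin) sorted_leq_last ?mem_tnth.
have /andP[ai_gt0 _] := a_bnd i.
have A_gt0 : (0 < gen_sum a)%N by rewrite /gen_sum (bigD1 i) //= ltn_addr.
have [B HB] := linf_set_contains _ _ i c a_bnd.
exists B%:Z => x Sx AP L; split; last first.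
  move=> _ [l Ll <-]; exists l%:Z => //.
  exact: linf_set_arith_prog (ha' i) Ll.
move=> r [/= m_itv [m /arith_progP dvd_m mE]].
move: m_itv; rewrite -{r}mE in_itv /= => /andP[low upp].
have m_ge0 : 0 <= m.
  rewrite -(ler_int R); apply: le_trans low.
  by rewrite addr_ge0 ?mulr_ge0 ?invr_ge0.
case: m m_ge0 dvd_m low upp => // m _ dvd_m; rewrite -!pmulrn => low upp.
have {}low : (x + c * gen_sum a <= m * gen_sum a)%N.
  rewrite -(ler_nat R) natrD !natrM -lerBrDr -mulrBl.
  by rewrite -ler_pdivrMr ?ltr0n // lerBrDr mulrC.
have {}upp : (m * tnth a i + B <= x)%N.
  have : (m * tnth a i + B * tnth a i <= x)%N.
    rewrite -(ler_nat R) natrD !natrM -mulrDl.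
    by rewrite -ler_pdivlMr ?ltr0n // -lerBrDr mulrC.
  by apply: leq_trans; rewrite leq_add2l leq_pmulr.
exists m => //; apply: HB => //.
move: dvd_m; rewrite -(dvdz_sub_inverse _ _ _ _ _ (ha' i)) -PoszM subzn //.
exact: leq_trans (leq_addr _ _) upp.
Qed.
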